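(* Let $n\in\{2,3,4,5,6\}$, let $L$ be an $n$-dimensional lattice in $\mathbb{R}^n$, let $\{e_1,\ldots,e_n\}$ be a Minkowski-reduced basis of $L$, and let $m=\sum_{i=1}^n x_ie_i$ (with $x_i\in\mathbb{Z}$) be an arbitrary minimal vector of $L$. Then for every index $i\in\{1,\ldots,n\}$: $$ |x_i|\leq \begin{cases} 1 & \text{if } n=2,3,\\ 2 & \text{if } n=4,5,\\ 3 & \text{if } n=6. \end{cases} $$
   Context: $\mathbb{R}^n$ carries the Euclidean norm $|\cdot|$. For linearly independent vectors $e_1,\ldots,e_n\in\mathbb{R}^n$, the $n$-dimensional lattice $L[e_1,\ldots,e_n]$ is the set of all linear combinations of $e_1,\ldots,e_n$ with integer coefficients; $\{e_1,\ldots,e_n\}$ is then a basis of it. A minimal vector of a lattice $L$ is a nonzero vector of $L$ whose length equals the minimum of the lengths of the nonzero vectors of $L$. A system of linearly independent lattice vectors $\{f_1,\ldots,f_k\}\subset L$ is a primitive system if $\mathrm{Lin}[f_1,\ldots,f_k]\cap L=L[f_1,\ldots,f_k]$, where $\mathrm{Lin}$ denotes the real linear span and $L[f_1,\ldots,f_k]$ the set of integer linear combinations. Minkowski-reduced basis: an ordered basis $\{a_1,\ldots,a_n\}$ of $L$ such that $a_1$ is a minimal vector of $L$ and, for each $i=2,\ldots,n$, $a_i$ is a shortest vector among all $v\in L$ such that $a_1,\ldots,a_{i-1},v$ are linearly independent and form a primitive system of $L$. Equivalently, the positive definite quadratic form $Q(u)=\left|\sum_{j=1}^n u_ja_j\right|^2$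 satisfies $Q(u)\ge Q(\varepsilon_i)=|a_i|^2$ for every $1\le i\le n$ and every $u=(u_1,\ldots,u_n)\in\mathbb{Z}^n$ with $\gcd(u_i,\ldots,u_n)=1$, where $\varepsilon_i$ is the $i$-th standard unit vector. *)

(* Defs.v *)
From mathcomp Require Import all_boot all_order all_algebra.
From mathcomp Require Import classical_sets reals.

Set Implicit Arguments.
Unset Strict Implicit.
Unset Printing Implicit Defensive.

Import Order.TTheory GRing.Theory Num.Theory.

Local Open Scope classical_set_scope.
Local Open Scope ring_scope.

(* The norm that MathComp-Analysis puts on 'rV[R]_n is the sup norm, hence a
   separate Euclidean norm. *)
Definition enorm (R : realType) (n : nat) (v : 'rV[R]_n) : R :=
  Num.sqrt (\sum_(j < n) v 0 j ^+ 2).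

(* L[f_1, ..., f_k]: the integer combinations of the vectors listed in s. *)
Definition int_span (R : realType) (n : nat) (s : seq 'rV[R]_n) :
    set 'rV[R]_n :=
  [set v | inIntSpan (in_tuple s) v].

Definition lattice_basis (R : realType) (n : nat) (L : set 'rV[R]_n)
    (e : n.-tuple 'rV[R]_n) : Prop :=
  free e /\ L = int_span e.

Definition is_lattice (R : realType) (n : nat) (L : set 'rV[R]_n) : Prop :=
  exists e : n.-tuple 'rV[R]_n, lattice_basis L e.

Definition minimal_vector (R : realType) (n : nat) (L : set 'rV[R]_n)
    (m : 'rV[R]_n) : Prop :=
  [/\ L m, m != 0 & forall v, L v -> v != 0 -> enorm m <= enorm v].

Definition primitive_system (R : realType) (n : nat) (L : set 'rV[R]_n)
    (f : seq 'rV[R]_n) : Prop :=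
  [/\ free f, (forall v, v \in f -> L v)
    & [set v | v \in <<f>>%VS] `&` L = int_span f].

(* The v in L that can follow the vectors of s in a primitive system;
   linear independence is part of primitive_system. *)
Definition primitive_extension (R : realType) (n : nat) (L : set 'rV[R]_n)
    (s : seq 'rV[R]_n) : set 'rV[R]_n :=
  [set v | L v /\ primitive_system L (rcons s v)].

(* Indices start at 0: a`_0, ..., a`_(n-1) are a_1, ..., a_n, and take i a
   lists the predecessors of a`_i. *)
Definition minkowski_reduced (R : realType) (n : nat) (L : set 'rV[R]_n)
    (a : n.-tuple 'rV[R]_n) : Prop :=
  [/\ lattice_basis L a, minimal_vector L a`_0
    & forall i : nat, (0 < i < n)%N ->
        primitive_extension L (take i a) a`_i /\
        (forall v, primitive_extension L (take i a) v ->
           enorm a`_i <= enorm v)].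

(* Main.v *)
Require Import Defs.
From mathcomp Require Import all_boot all_order all_algebra.
From mathcomp Require Import classical_sets reals.
From mathcomp Require Import zify ring lra.

Set Implicit Arguments.
Unset Strict Implicit.
Unset Printing Implicit Defensive.

Import Order.TTheory GRing.Theory Num.Theory.

Local Open Scope ring_scope.

(** Let mu be the square of the minimal length and q(v) = |v|^2. If
    d c = b m + sum_l a_l e_l with c in the lattice, Watson's identity
      |b| (q(c - sgn(b) m) - q(m)) + sum_l |a_l| (q(c - sgn(a_l) e_l) - q(e_l))
        = (|b| + sum_l |a_l| - 2 d) q(c)
    and the minimality of mu give 2 d mu <= |b| mu + sum_l |a_l| q(e_l).
    For d dividing some x_i <> 0 and d not dividing t, take for c the rounding
    of t x / d: then |b| and |a_l| become the distances of t and t x_l to d Z.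
    Averaging over t bounds 1 + sum_l q(e_l) / mu (over the l with d not
    dividing x_l) from below, which for n <= 6 and short e_l only leaves
    d = 2 and, when n = 6, d = 3.
    The e_l are short: if gcd(x_j, ..., x_n) = 1, then Minkowski reduction
    gives q(e_j) <= q(m) = mu. If e_j is the first vector longer than m and
    x_j, ..., x_n are not all 0, the same bounds force that gcd to be 2, and
    comparing e_j with the vectors (m + sum +-e_l) / 2, l ranging over the
    odd x_l, gives q(e_j) <= 5/4 mu or q(e_j) <= 3/2 mu. *)

(** * Primitive extensions from coprime coordinates *)

Section IntegerSpan.
Variables (R : realType) (n : nat).
Implicit Types (s : seq 'rV[R]_n) (u v : 'rV[R]_n).

Lemma int_span_mem s v : v \in s -> int_span s v.
Proof.
move=> vs; have lt_i : (index v s < size s)%N by rewrite index_mem.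
exists [ffun i : 'I_(size s) => (i == Ordinal lt_i)%:Z].
rewrite (bigD1 (Ordinal lt_i)) //= ffunE eqxx nth_index // mulr1z.
by rewrite big1 ?addr0 // => i /negPf ni; rewrite ffunE ni mulr0z.
Qed.

Lemma int_spanD s u v : int_span s u -> int_span s v -> int_span s (u + v).
Proof.
move=> [a ->] [b ->]; exists [ffun i => a i + b i].
by rewrite -big_split; apply: eq_bigr => i _; rewrite ffunE mulrzDr.
Qed.

Lemma int_spanMz s u z : int_span s u -> int_span s (u *~ z).
Proof.
move=> [a ->]; exists [ffun i => a i * z].
by rewrite mulrz_suml; apply: eq_bigr => i _; rewrite ffunE mulrzA.
Qed.

Lemma int_span0 s : int_span s 0.
Proof.
by exists [ffun=> 0]; rewrite big1 // => i _; rewrite ffunE mulr0z.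
Qed.

Lemma int_span_sum s (I : finType) (P : pred I) (F : I -> 'rV[R]_n) :
  (forall i, P i -> int_span s (F i)) -> int_span s (\sum_(i | P i) F i).
Proof.
move=> sF; apply: (big_ind (int_span s)) => //; first exact: int_span0.
exact: int_spanD.
Qed.

Lemma int_span_sub s s' :
  (forall v, v \in s -> int_span s' v) ->
  forall v, int_span s v -> int_span s' v.
Proof.
move=> ss' _ [a ->]; apply: int_span_sum => i _; apply/int_spanMz/ss'.
by rewrite mem_nth.
Qed.

Lemma int_span_span s v : int_span s v -> v \in <<s>>%VS.
Proof.
case=> a ->; apply: memv_suml => i _.
by rewrite -scaler_int memvZ // memv_span // mem_nth.
Qed.

Lemma coord_take (e : n.-tuple 'rV[R]_n) j v (l : 'I_n) :
  free e -> v \in <<take j e>>%VS -> (j <= l)%N -> coord e l v = 0.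
Proof.
move=> fe ve jl; move: (ve); rewrite -[take j e]in_tupleE => /coord_span ->.
rewrite linear_sum big1 // => -[i li] _ /=.
have [ij i_n] : (i < j)%N /\ (i < n)%N.
  by move: li; rewrite size_take size_tuple; case: (ltnP j n); lia.
rewrite linearZ /= nth_take // (coord_free (Ordinal i_n)) //.
by case: eqP => [E|_]; rewrite ?mulr0 //; move: jl; rewrite -E /=; lia.
Qed.

Lemma coord_int (e : n.-tuple 'rV[R]_n) (a : 'I_n -> int) (l : 'I_n) :
  free e -> coord e l (\sum_(i < n) e`_i *~ a i) = (a l)%:~R.
Proof.
move=> fe; rewrite linear_sum (bigD1 l) //= -scaler_int linearZ /= coord_free //.
rewrite eqxx mulr1 big1 ?addr0 // => i /negPf il.
by rewrite -scaler_int linearZ /= coord_free // il mulr0.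
Qed.

(** Write r as p/q in lowest terms: q divides p u_l and is prime to p, so it divides every u_l, and
    q = 1. *)
Lemma coprime_int_multiplier (P : pred 'I_n) (u a : 'I_n -> int) (r : R) :
  (forall d : nat, (forall l, P l -> (d %| `|u l|)%N) -> d = 1%N) ->
  (forall l, P l -> (a l)%:~R = r * (u l)%:~R) -> exists z : int, r = z%:~R.
Proof.
move=> gu au; have [/existsP[l /andP[Pl ul]]|] := boolP [exists l, P l && (u l != 0)];
    last first.
  (* If every [u l] vanished, 2 would be a common divisor: coprimality excludes a zero family, here
     and below. *)
  move=> /existsPn u0; suff: 2%N = 1%N by [].
  by apply: gu => l Pl; have:= u0 l; rewrite Pl negbK => /eqP->.
pose q : rat := (a l)%:~R / (u l)%:~R.
have rq : r = ratr q.
  rewrite fmorph_div /= !ratr_int; apply: (canRL (mulfK _)); first by rewrite intr_eq0.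
  by rewrite au.
have {rq} rq : r = (numq q)%:~R / (denq q)%:~R.
  by rewrite rq -[in LHS](divq_num_den q) fmorph_div /= !ratr_int.
suff dq1 : denq q = 1 by exists (numq q); rewrite rq dq1 divr1.
suff: `|denq q|%N = 1%N by move: (denq_gt0 q); lia.
apply: gu => k Pk.
have: (numq q)%:~R * (u k)%:~R = (denq q)%:~R * (a k)%:~R :> R.
  rewrite (au _ Pk) rq mulrA [_ * (_ / _)]mulrC divfK //.
  by rewrite intr_eq0 denq_eq0.
rewrite -!intrM => /intr_inj /(congr1 absz); rewrite !abszM => E.
rewrite -(@Gauss_dvdr _ `|numq q|%N); first by rewrite E dvdn_mulr.
by rewrite coprime_sym coprime_num_den.
Qed.

Lemma int_span_tuple (e : n.-tuple 'rV[R]_n) w : int_span e w ->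
  exists A : 'I_n -> int, w = \sum_(l < n) e`_l *~ A l.
Proof.
case=> A ->; pose f := cast_ord (esym (size_tuple e)).
exists (fun l => A (f l)).
rewrite (reindex f) //; apply: onW_bij; exists (cast_ord (size_tuple e)).
  exact: cast_ordKV.
exact: cast_ordK.
Qed.

(** This passes from the primitive systems of the definition to the inequalities Q(u) >=
    Q(epsilon_j). A lattice vector in the span is r v plus a combination of the e_l with l < j; its
    coordinates from j on are r u_l, so r is an integer. *)
Lemma primitive_extension_coprime (L : set 'rV[R]_n) (e : n.-tuple 'rV[R]_n)
    (j : nat) (u : 'I_n -> int) :
  lattice_basis L e ->
  (forall d : nat, (forall l : 'I_n, (j <= l)%N -> (d %| `|u l|)%N) -> d = 1%N) ->
  primitive_extension L (take j e) (\sum_(l < n) e`_l *~ u l).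
Proof.
move=> [fe Le] gu; set v := \sum_(l < n) _.
have eL i : (i < n)%N -> L e`_i.
  by move=> i_n; rewrite Le; apply: int_span_mem; rewrite mem_nth ?size_tuple.
have Lv : L v.
  rewrite Le; apply: int_span_sum => l _; apply: int_spanMz.
  by rewrite -Le; apply: eL.
have sL w : w \in rcons (take j e) v -> L w.
  rewrite mem_rcons inE => /predU1P[-> //|/mem_take we].
  by rewrite Le; apply: int_span_mem.
split=> //; split=> //.
- have /perm_free-> : perm_eq (rcons (take j e) v) (v :: take j e).
    by rewrite perm_rcons.
  rewrite free_cons; have := fe; rewrite -[X in free X](cat_take_drop j).
  move=> /catl_free->; rewrite andbT; apply/negP => vs.
  suff: 2%N = 1%N by [].
  apply: gu => l jl; have := coord_take fe vs jl; rewrite coord_int //.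
  by move/eqP; rewrite intr_eq0 => /eqP->.
apply/seteqP; split=> [w|w sw]; last first.
  split; first exact: int_span_span.
  by rewrite Le; apply: int_span_sub sw => x /sL; rewrite Le.
case=> ws; rewrite Le => /int_span_tuple[A wA].
have [r yr] : exists r, w - r *: v \in <<take j e>>%VS.
  move: ws; have/eq_span-> : rcons (take j e) v =i v :: take j e.
    by move=> x; rewrite mem_rcons.
  rewrite span_cons => /memv_addP[_ /vlineP[r ->]] [y ys ->].
  by exists r; rewrite addrC addKr.
have rA (l : 'I_n) : (j <= l)%N -> (A l)%:~R = r * (u l)%:~R.
  move=> jl; have := coord_take fe yr jl.
  by rewrite linearB linearZ /= wA !coord_int // => /eqP; rewrite subr_eq0 => /eqP.
have [z rz] := coprime_int_multiplier gu rA.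
have -> : w = \sum_(l < n | (l < j)%N) e`_l *~ (A l - u l * z) + v *~ z.
  rewrite big_mkcond mulrz_suml -big_split wA; apply: eq_bigr => l _ /=.
  case: ltnP => jl; first by rewrite -mulrzA -mulrzDr subrK.
  rewrite add0r -mulrzA; congr (_ *~ _).
  by apply/eqP; rewrite -(eqr_int R) (rA _ jl) intrM rz mulrC.
apply: int_spanD; last by apply/int_spanMz/int_span_mem; rewrite mem_rcons mem_head.
apply: int_span_sum => l lj; apply/int_spanMz/int_span_mem.
rewrite mem_rcons inE -(nth_take 0 lj) mem_nth ?orbT // size_take size_tuple.
by case: (ltnP j n).
Qed.
End IntegerSpan.

(** * Distance to the multiples of an integer *)

Section Nearest.

(** A nearest integer to y/d for d > 0, with ties rounded down. *)
Definition nearz (d : nat) (y : int) : int :=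
  if (2 * `|(y %% d)%Z| <= d)%N then (y %/ d)%Z else (y %/ d)%Z + 1.

(** For d > 0 the remainder lies in [0, d), so this is the distance from y to dZ. *)
Definition distz (d : nat) (y : int) : nat :=
  minn `|(y %% d)%Z| (d - `|(y %% d)%Z|).

Lemma nearzP d y : (0 < d)%N -> absz (d%:Z * nearz d y - y)%R = distz d y.
Proof.
move=> d0; rewrite /nearz /distz.
have yE := divz_eq y d; have r0 : 0 <= (y %% d)%Z by apply: modz_ge0; lia.
have rd : (y %% d)%Z < d by apply: ltz_pmod; lia.
move: yE r0 rd; set q := (y %/ d)%Z; set r := (y %% d)%Z => yE r0 rd.
by case: ifP; nia.
Qed.

Lemma nearz_mul (d : nat) y : (0 < d)%N -> (d %| y)%Z -> d%:Z * nearz d y = y.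
Proof.
move=> d0 dy; have := nearzP y d0; rewrite /distz.
by move/dvdz_mod0P: dy => ->; lia.
Qed.

Lemma distz_mod (d : nat) y : distz d (y %% d)%Z = distz d y.
Proof. by rewrite /distz modz_mod. Qed.

Lemma distz_modM (d : nat) y z : distz d (y * (z %% d)%Z) = distz d (y * z).
Proof. by rewrite -distz_mod modzMmr distz_mod. Qed.

Lemma distz_dvd (d : nat) y : (d %| y)%Z -> distz d y = 0%N.
Proof. by move=> /dvdz_mod0P; rewrite /distz => ->; rewrite min0n. Qed.

Lemma distz_le d y : (2 * distz d y <= d)%N.
Proof. by rewrite /distz; lia. Qed.

Lemma distz_gt0 (d : nat) y : (0 < d)%N -> ~~ (d %| y)%Z -> (0 < distz d y)%N.
Proof.
move=> d0; rewrite (sameP dvdz_mod0P eqP) /distz.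
have r0 : 0 <= (y %% d)%Z by apply: modz_ge0; lia.
have rd : (y %% d)%Z < d by apply: ltz_pmod; lia.
by lia.
Qed.

Lemma distz_eqmod (d : nat) y z : (y = z %[mod d])%Z -> distz d y = distz d z.
Proof. by move=> yz; rewrite -distz_mod yz distz_mod. Qed.

Lemma nearz0 d : nearz d 0 = 0.
Proof. by rewrite /nearz div0z mod0z. Qed.

End Nearest.

(** * Watson's identity and minimal vectors *)

Section Euclidean.
Variables (R : realType) (n : nat).
Implicit Types (u v w : 'rV[R]_n).

Definition dot u v : R := \sum_(j < n) u 0 j * v 0 j.
Definition sqn v : R := dot v v.

Lemma dotC u v : dot u v = dot v u.
Proof. by apply: eq_bigr => j _; rewrite mulrC. Qed.

Lemma dotDl u v w : dot (u + v) w = dot u w + dot v w.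
Proof. by rewrite -big_split; apply: eq_bigr => j _; rewrite mxE mulrDl. Qed.

Lemma dotZl (a : R) u v : dot (a *: u) v = a * dot u v.
Proof. by rewrite mulr_sumr; apply: eq_bigr => j _; rewrite mxE mulrA. Qed.

Lemma dotDr u v w : dot w (u + v) = dot w u + dot w v.
Proof. by rewrite dotC dotDl !(dotC w). Qed.

Lemma dotZr (a : R) u v : dot v (a *: u) = a * dot v u.
Proof. by rewrite dotC dotZl dotC. Qed.

Lemma dot0r u : dot u 0 = 0.
Proof. by rewrite -(scale0r u) dotZr mul0r. Qed.

Lemma dot_sumr (I : finType) (F : I -> 'rV[R]_n) u :
  dot u (\sum_i F i) = \sum_i dot u (F i).
Proof.
exact: (big_morph (dot u) (fun v w => dotDr v w u) (dot0r u)).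
Qed.

Lemma sqnZ (a : R) u : sqn (a *: u) = a ^+ 2 * sqn u.
Proof. by rewrite /sqn dotZl dotZr mulrA. Qed.

Lemma sqnB (a : R) u v :
  sqn (u - a *: v) = sqn u - 2 * a * dot u v + a ^+ 2 * sqn v.
Proof.
rewrite -scaleNr /sqn dotDl !dotDr !dotZl !dotZr (dotC v u); ring.
Qed.

Lemma sqn_ge0 u : 0 <= sqn u.
Proof. by apply: sumr_ge0 => j _; rewrite -expr2 sqr_ge0. Qed.

Lemma enorm_le u v : (enorm u <= enorm v) = (sqn u <= sqn v).
Proof.
have enormE w : enorm w = Num.sqrt (sqn w).
  by congr Num.sqrt; apply: eq_bigr => j _; rewrite expr2.
by rewrite !enormE ler_sqrt ?sqn_ge0.
Qed.

(** Each term expands to |t| q(c) - 2 <c, t w>, and the inner products add up to <c, d c> = d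
    q(c). *)
Lemma watson (k : nat) (d b : R) (a : 'I_k -> R) c v (f : 'I_k -> 'rV[R]_n) :
  d *: c = b *: v + \sum_l a l *: f l ->
  `|b| * (sqn (c - Num.sg b *: v) - sqn v)
    + \sum_l `|a l| * (sqn (c - Num.sg (a l) *: f l) - sqn (f l))
  = (`|b| + \sum_l `|a l| - 2 * d) * sqn c.
Proof.
have term (t : R) w :
    `|t| * (sqn (c - Num.sg t *: w) - sqn w) = `|t| * sqn c - 2 * dot c (t *: w).
  rewrite sqnB dotZr; have [->|t0] := eqVneq t 0; first by rewrite normr0; ring.
  by rewrite sqr_sg t0 /= mulr1n [in 2 * (t * _)](numEsg t); ring.
move=> dc; rewrite term; under eq_bigr do rewrite term.
rewrite sumrB -mulr_suml -mulr_sumr -dot_sumr !mulrBl mulrDl.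
have -> : 2 * d * sqn c = 2 * dot c (d *: c) by rewrite dotZr mulrA.
by rewrite dc dotDr; ring.
Qed.

(* Each sign is chosen so that the cross term is nonpositive. *)
Lemma exists_signs (k : nat) v (f : nat -> 'rV[R]_n) :
  exists s : nat -> int, (forall l, s l = 1 \/ s l = -1) /\
    sqn (v + \sum_(l < k) (s l)%:~R *: f l) <= sqn v + \sum_(l < k) sqn (f l).
Proof.
elim: k => [|k [s [s1 IH]]].
  by exists (fun=> 1); split; [left | rewrite !big_ord0 !addr0].
pose w := v + \sum_(l < k) (s l)%:~R *: f l.
pose t : int := if 0 <= dot w (f k) then -1 else 1.
exists (fun l => if l == k then t else s l); split=> [l|].
  by rewrite /t; case: ifP; first case: ifP; auto.
rewrite !big_ord_recr /= eqxx !addrA.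
have -> : \sum_(i < k) (if (i : nat) == k then t else s i)%:~R *: f i
          = \sum_(l < k) (s l)%:~R *: f l.
  by apply: eq_bigr => i _; case: eqP (ltn_ord i) => // ->; rewrite ltnn.
apply: le_trans (lerD IH (lexx _)); rewrite -/w.
have -> : w + t%:~R *: f k = w - (- t%:~R) *: f k by rewrite scaleNr opprK.
rewrite sqnB /t; case: (lerP 0 (dot w (f k))) => wf.
  by rewrite mulrNz opprK; nra.
by nra.
Qed.

End Euclidean.

(** * Inequalities satisfied by the coordinates of a minimal vector *)

Section MinimalVector.
Variables (R : realType) (n : nat) (e : nat -> 'rV[R]_n).

(* Six indices serve all n <= 6: [e] will be 0 beyond the rank of the lattice. *)
Definition ivec (u : nat -> int) : 'rV[R]_n := \sum_(l < 6) (u l)%:~R *: e l.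

Lemma ivecB (u v : nat -> int) (z : int) :
  ivec (fun l => u l - z * v l) = ivec u - z%:~R *: ivec v.
Proof.
rewrite scaler_sumr -sumrB; apply: eq_bigr => l _.
by rewrite scalerA -scalerBl -intrM -intrB.
Qed.

Lemma ivec_delta l : (l < 6)%N -> ivec (fun k => (k == l)%:Z) = e l.
Proof.
move=> l6; rewrite /ivec (bigD1 (Ordinal l6)) //= eqxx scale1r.
rewrite big1 ?addr0 // => i /negPf il.
by rewrite -val_eqE /= in il; rewrite il scale0r.
Qed.

Lemma ivecB_basis (u : nat -> int) l (z : int) : (l < 6)%N ->
  ivec (fun k => u k - z * (k == l)%:Z) = ivec u - z%:~R *: e l.
Proof. by move=> l6; rewrite ivecB ivec_delta. Qed.

Lemma ivec_rel (d b : int) (c x : nat -> int) :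
  d%:~R *: ivec c
  = b%:~R *: ivec x + \sum_(l < 6) (d * c l - b * x l)%:~R *: e l.
Proof.
rewrite !scaler_sumr -big_split; apply: eq_bigr => l _ /=.
by rewrite !scalerA -scalerDl -!intrM -intrD addrC subrK.
Qed.

Lemma watson_ivec (d b : int) (a c y : nat -> int) :
  (forall l, a l = d * c l - b * y l) ->
  `|b|%:~R * (sqn (ivec (fun k => c k - Num.sg b * y k)) - sqn (ivec y))
    + \sum_(l < 6) `|a l|%:~R
        * (sqn (ivec (fun k => c k - Num.sg (a l) * (k == l)%:Z)) - sqn (e l))
  = (`|b|%:~R + \sum_(l < 6) `|a l|%:~R - 2 * d%:~R) * sqn (ivec c).
Proof.
move=> aE; have absE l : `|(a l)%:~R : R| = `|a l|%:~R by rewrite intr_norm.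
have := ivec_rel d b c y.
under [in X in _ = X -> _]eq_bigr => l _ do rewrite -aE.
move/watson.
rewrite -[`|b%:~R|]intr_norm -[Num.sg b%:~R]intr_sg -ivecB.
under eq_bigr => l _ do rewrite -[Num.sg (a l)%:~R]intr_sg -ivecB_basis // absE.
by under [in X in _ = X -> _]eq_bigr => l _ do rewrite absE.
Qed.

Variables (mu : R) (x : nat -> int).
Hypotheses (n6 : (n <= 6)%N) (mu_gt0 : 0 < mu)
  (min_le : forall (u : nat -> int) l, (l < n)%N -> u l != 0 -> mu <= sqn (ivec u))
  (red_le : forall j u, (j < n)%N ->
     (forall d : nat,
        (forall l, (j <= l < n)%N -> (d%:Z %| u l)%Z) -> d = 1%N) ->
     sqn (e j) <= sqn (ivec u))
  (x_out : forall l, (n <= l)%N -> x l = 0)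
  (x_sqn : sqn (ivec x) = mu).

Lemma x_lt l : x l != 0 -> (l < n)%N.
Proof. by case: (leqP n l) => // /x_out->. Qed.

Lemma mu_le_basis l : (l < n)%N -> mu <= sqn (e l).
Proof.
move=> ln; rewrite -ivec_delta ?(leq_trans ln) //.
by apply: (min_le ln); rewrite eqxx.
Qed.

(** Coordinate i keeps every vector of Watson's identity nonzero, so all the squares are at least
    mu: a_i = 0, hence c -+ e_l with a_l nonzero retains the coordinate c_i, and c_i differs from
    sgn(b) x_i. *)
Lemma watson_bound (d : nat) (b : int) (c : nat -> int) i :
  x i != 0 -> d%:Z * c i = b * x i -> 0 < `|b| < d%:Z ->
  (forall l, (n <= l)%N -> c l = 0) ->
  (2 * d)%:R * mu
  <= `|b|%:~R * mu + \sum_(l < 6) `|d%:Z * c l - b * x l|%:~R * sqn (e l).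
Proof.
move=> xi dc /andP[b0 bd] c_out; have i_n := x_lt xi.
have ci : c i != 0 by apply/eqP=> ci; move: dc xi; rewrite ci; nia.
pose a l := d%:Z * c l - b * x l.
have := @watson_ivec d b a c x (fun=> erefl); rewrite x_sqn; set Q := sqn (ivec c).
have Q_ge : mu <= Q by apply: min_le i_n ci.
(* Equality in coordinate i would give b = d sgn(b), against 0 < |b| < d. *)
have b_term : 0 <= `|b|%:~R * (sqn (ivec (fun k => c k - Num.sg b * x k)) - mu).
  apply: mulr_ge0; first by rewrite ler0z.
  rewrite subr_ge0; apply: (min_le i_n); apply/eqP=> E.
  have: d%:Z * c i = d%:Z * (Num.sg b * x i) by lia.
  by rewrite dc mulrA => /(mulIf xi); move: b0 bd; case: sgrP; lia.
pose S : R := \sum_(l < 6) `|a l|%:~R.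
have a0_out l : (n <= l)%N -> a l = 0.
  by move=> nl; rewrite /a c_out // x_out // !mulr0 subrr.
have S_le : S * mu <= \sum_(l < 6) `|a l|%:~R * sqn (e l).
  rewrite mulr_suml; apply: ler_sum => l _; have [/a0_out->|ln] := leqP n l.
    by rewrite normr0 !mul0r.
  by rewrite ler_wpM2l ?ler0z // mu_le_basis.
pose X : R := \sum_(l < 6) `|a l|%:~R * sqn (e l).
rewrite -/X in S_le; rewrite -[Y in _ <= _ + Y]/X.
move=> E; have: S * mu - X <= (`|b|%:~R + S - 2 * d%:R) * Q.
  rewrite -[X in _ <= X]E; apply: le_trans (_ : _ <= 0 + _) (lerD b_term (lexx _)).
  rewrite add0r mulr_suml -sumrB.
  apply: ler_sum => l _; have [->|al] := eqVneq (a l) 0.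
    by rewrite normr0 !mul0r subrr.
  rewrite -mulrBr ler_wpM2l ?ler0z // lerD2r; apply: (min_le i_n).
  suff /negPf-> : i != l by rewrite mulr0 subr0.
  by apply: contraNneq al => <-; rewrite /a dc subrr.
have B0 : 0 <= `|b|%:~R :> R by rewrite ler0z.
rewrite natrM; move: S_le; move: (`|b|%:~R : R) (d%:R : R) B0 => B D B0 S_le XQ.
(* For B + S >= 2 D the bound already follows from X >= S mu; otherwise the factor of Q is negative
   and Q >= mu is used. *)
have [big|small] := leP (2 * D) (B + S).
  by have := ler_wpM2r (ltW mu_gt0) big; rewrite mulrDl; lra.
have := ler_wnM2l (_ : B + S - 2 * D <= 0) Q_ge; move=> /(_ ltac:(lra)).
by rewrite !mulrBl !mulrDl in XQ *; lra.
Qed.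

(* The basis vectors with x_l = 0 play no role and may be arbitrarily long. *)
Definition weight l : R := if x l == 0 then 0 else sqn (e l) / mu.

Lemma weight_ge0 l : 0 <= weight l.
Proof.
by rewrite /weight; case: eqP => // _; rewrite divr_ge0 ?sqn_ge0 // ltW.
Qed.

Lemma weightK l : x l != 0 -> weight l * mu = sqn (e l).
Proof. by rewrite /weight => /negPf->; rewrite divfK // gt_eqF. Qed.

Lemma weight_mul_le l : weight l * mu <= sqn (e l).
Proof.
have [xl|/weightK-> //] := eqVneq (x l) 0.
by rewrite /weight xl eqxx mul0r sqn_ge0.
Qed.

Lemma mulr_weightK (r : R) l : (x l = 0 -> r = 0) -> r * weight l * mu = r * sqn (e l).
Proof.
move=> r0; have [/r0->|xl] := eqVneq (x l) 0; first by rewrite !mul0r.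
by rewrite -mulrA weightK.
Qed.

(** Here b is a residue of t modulo d of least absolute value and c_l a nearest integer to b x_l /
    d; c_i is exact because d divides x_i. *)
Lemma distz_bound (d t : nat) i :
  x i != 0 -> (d %| x i)%Z -> ~~ (d %| t)%N ->
  (2 * d)%:R <= (distz d t)%:R + \sum_(l < 6) (distz d (t%:Z * x l))%:R * weight l.
Proof.
move=> xi dxi dt; have d0 : (0 < d)%N.
  by case: d dxi {dt} => //; rewrite dvd0z (negPf xi).
pose b : int := t%:Z - d%:Z * nearz d t.
have b_abs : `|b|%N = distz d t by rewrite -nearzP //; lia.
have bt : (b = t%:Z %[mod d])%Z.
  by rewrite /b mulrC -mulNr addrC modzMDl.
pose c l := nearz d (b * x l).
have c_abs l : absz (d%:Z * c l - b * x l)%R = distz d (t%:Z * x l).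
  by rewrite nearzP //; apply: distz_eqmod; rewrite -modzMml bt modzMml.
have dci : d%:Z * c i = b * x i by rewrite nearz_mul // dvdz_mull.
have dt0 : (0 < distz d t)%N by apply: distz_gt0.
have b_lt : 0 < `|b| < d%:Z by have := distz_le d t; lia.
have c_out l : (n <= l)%N -> c l = 0.
  by move=> nl; rewrite /c x_out // mulr0 nearz0.
have absE (y : int) : `|y|%:~R = (absz y)%:R :> R by rewrite -abszE.
rewrite -(ler_pM2r mu_gt0) mulrDl mulr_suml.
apply: le_trans (watson_bound xi dci b_lt c_out) _.
rewrite absE b_abs lerD2l; apply: ler_sum => l _.
rewrite absE c_abs mulr_weightK // => ->.
by rewrite mulr0 distz_dvd ?dvdz0.
Qed.

Lemma weight_le1_of_coprime j : (j < n)%N ->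
  (forall d : nat, (forall l, (j <= l < n)%N -> (d %| x l)%Z) -> d = 1%N) ->
  weight j <= 1.
Proof.
move=> jn gx; rewrite /weight; case: eqP => // _.
by rewrite ler_pdivrMr // mul1r -x_sqn red_le.
Qed.

(** From j on, the coordinates of (m + sum +-e_l) / 2 are the coprime x_l / 2, so this vector
    competes with e_j; the signs from [exists_signs] bound its square. *)
Lemma weight_le_of_gcd2 j : (j < n)%N ->
  (forall l, (j <= l < n)%N -> (2 %| x l)%Z) ->
  (forall d : nat, (forall l, (j <= l < n)%N -> ((2 * d)%N %| x l)%Z) -> d = 1%N) ->
  4 * weight j <= 1 + \sum_(l < 6 | ~~ (2 %| x l)%Z) weight l.
Proof.
move=> jn x2 gx; pose f l := if (2 %| x l)%Z then 0 else e l.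
have [s [s1 s_le]] := exists_signs 6 (ivec x) f.
pose c l : int := if (2 %| x l)%Z then (x l %/ 2)%Z else ((x l + s l) %/ 2)%Z.
have c2 l : 2 * c l = x l + (if (2 %| x l)%Z then 0 else s l).
  by rewrite /c; case: ifP; have := s1 l; lia.
have cE : 2%:R *: ivec c = ivec x + \sum_(l < 6) (s l)%:~R *: f l.
  rewrite scaler_sumr -big_split; apply: eq_bigr => l _.
  rewrite scalerA -[2%:R]/(2%:~R) -intrM c2 /f.
  rewrite /=; case: ifP => _; first by rewrite scaler0 !addr0.
  by rewrite intrD scalerDl.
have cj : sqn (e j) <= sqn (ivec c).
  apply: red_le => // d dc; apply: gx => l jl; have := dc l jl.
  have := c2 l; rewrite x2 // addr0 => <-.
  by rewrite PoszM => ?; rewrite dvdz_mul.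
move: s_le; rewrite -cE sqnZ x_sqn => s_le.
have sumE : \sum_(l < 6) sqn (f l)
            = (\sum_(l < 6 | ~~ (2 %| x l)%Z) weight l) * mu.
  rewrite mulr_suml [in RHS]big_mkcond; apply: eq_bigr => l _; rewrite /f.
  case: ifP => xl /=; first exact: dot0r.
  by rewrite weightK //; apply: contraFneq xl => ->; rewrite dvdz0.
rewrite -(ler_pM2r mu_gt0) [in X in _ <= X]mulrDl mul1r -sumE.
apply: le_trans s_le.
apply: le_trans (_ : 4 * sqn (e j) <= _); last by rewrite expr2; lra.
by rewrite -mulrA ler_wpM2l // weight_mul_le.
Qed.

Lemma sum6_le5 (g : nat -> R) j :
  (j < 6)%N -> g j = 0 -> (forall l, g l <= 1) -> \sum_(l < 6) g l <= 5.
Proof.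
move=> j6 gj g1; rewrite !big_ord_recr big_ord0 /=.
move: (g1 0%N) (g1 1%N) (g1 2%N) (g1 3%N) (g1 4%N) (g1 5%N).
by case: j j6 gj => [|[|[|[|[|[|j]]]]]] // _ ->; rewrite add0r; lra.
Qed.

(** Watson's identity with d = 3, b = 1 and c the rounding of x / 3. The vectors c and c -+ e_l, l <
    j, have the coprime coordinates x_l / 3 from j on, so their squares are at least q(e_j). *)
Lemma weight_le_of_gcd3 j : (j < n)%N ->
  (forall l, (j <= l < n)%N -> (3 %| x l)%Z) ->
  (forall d : nat, (forall l, (j <= l < n)%N -> ((3 * d)%N %| x l)%Z) -> d = 1%N) ->
  5 * weight j <= \sum_(l < 6) (distz 3 (x l))%:R * weight l.
Proof.
move=> jn x3 gx; pose c l := nearz 3 (x l); pose a l := 3 * c l - 1 * x l.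
have a_abs l : absz (a l) = distz 3 (x l) by rewrite -nearzP // /a mul1r.
have a0 l : (j <= l)%N -> a l = 0.
  move=> jl; apply/eqP; rewrite -absz_eq0 a_abs; apply/eqP/distz_dvd.
  by have [ln|nl] := ltnP l n; [rewrite x3 ?jl | rewrite x_out].
have [i ji xi] : exists2 i, (j <= i < n)%N & x i != 0.
  have [/existsP[i /andP[? ?]]|] := boolP [exists i : 'I_n, (j <= i)%N && (x i != 0)].
    by exists i => //; apply/andP.
  move/existsPn => x0; suff: 2%N = 1%N by [].
  apply: gx => l /andP[jl ln]; have := x0 (Ordinal ln).
  by rewrite /= jl /= negbK => /eqP->; rewrite dvdz0.
have i_n : (i < n)%N by case/andP: ji.
have c3 : 3 * c i = x i by have := a0 i; rewrite /a; case/andP: ji => -> _ /(_ isT); lia.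
have red_tail u : (forall l, (j <= l)%N -> u l = c l) -> sqn (e j) <= sqn (ivec u).
  move=> uc; apply: red_le => // d du; apply: gx => l jl.
  have jl' : (j <= l)%N by case/andP: jl.
  have := du l jl; rewrite uc // => dc; have := a0 l jl'.
  rewrite /a mul1r => /eqP; rewrite subr_eq0 => /eqP <-.
  by rewrite PoszM dvdz_mul.
have := @watson_ivec 3 1 a c x (fun=> erefl); rewrite x_sqn normr1 sgr1.
set A := _ * _; set S : R := \sum_(l < 6) `|a l|%:~R.
have A0 : 0 <= A.
  rewrite /A mul1r subr_ge0.
  by apply: (@min_le (fun k => c k - 1 * x k) i) => //; lia.
(* The rounding errors are at most 1 and vanish at j. Thus 1 + S - 6 is nonpositive, and q(c) may be
   replaced by q(e_j). *)
have S5 : S <= 5.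
  apply: (@sum6_le5 (fun l => `|a l|%:~R) j); first by lia.
    by rewrite a0.
  by move=> l; rewrite -abszE a_abs lern1; have := distz_le 3 (x l); lia.
have c_ge := red_tail c (fun _ _ => erefl).
pose X : R := \sum_(l < 6) `|a l|%:~R * sqn (e l).
move=> E; have XE : S * sqn (e j) - X <= (S - 5) * sqn (ivec c).
  have -> : (S - 5) * sqn (ivec c) = (1 + S - 2 * 3%:~R) * sqn (ivec c).
    by congr (_ * _); lra.
  rewrite -E -[Y in Y <= _]add0r; apply: lerD => //.
  rewrite mulr_suml -sumrB; apply: ler_sum => l _.
  have [/a0->|lj] := leqP j l; first by rewrite normr0 !mul0r subrr.
  rewrite -mulrBr ler_wpM2l ?ler0z // lerD2r; apply: red_tail => k jk.
  by rewrite gtn_eqF ?mulr0 ?subr0 // (leq_trans lj).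
have {XE} : 5 * sqn (e j) <= X.
  have := ler_wnM2l (_ : S - 5 <= 0) c_ge; rewrite subr_le0 => /(_ S5).
  by rewrite !mulrBl in XE *; lra.
have XwE : X = (\sum_(l < 6) (distz 3 (x l))%:R * weight l) * mu.
  rewrite mulr_suml; apply: eq_bigr => l _; rewrite mulr_weightK.
    by rewrite -abszE a_abs.
  by move=> ->; rewrite distz_dvd ?dvdz0.
rewrite XwE => jX; rewrite -(ler_pM2r mu_gt0) -mulrA; apply: le_trans jX.
by rewrite ler_wpM2l // weight_mul_le.
Qed.

(* With only light vectors, the bounds for t = 1, 2 force exactly three odd x_l
   and two x_l = 2 mod 4. With h = (m + sum_odd +-e_l) / 2, Watson's identity for
   h - m gives q(h) <= mu, and then some lattice vector (h +- e_p +- e_q) / 2 is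
   shorter than m. *)
Lemma index4_has_heavy i :
  x i != 0 -> (4 %| x i)%Z ->
  ~ (forall l, ~~ (4 %| x l)%Z -> weight l <= 1).
Proof.
move=> xi x4 w1; have i_n := x_lt xi; have i6 : (i < 6)%N by lia.
pose c l := nearz 4 (x l).
have c_abs l : absz (4%:Z * c l - x l)%R = distz 4 (x l) by rewrite nearzP.
have ci : 4 * c i = x i by rewrite /c (@nearz_mul 4).
pose A l := ~~ (2 %| x l)%Z; pose B l := (2 %| x l)%Z && ~~ (4 %| x l)%Z.
have dist1 l : distz 4 (x l) = (A l + 2 * B l)%N.
  rewrite /A /B /distz; lia.
have dist2 l : distz 4 (2%:Z * x l) = (2 * A l)%N.
  rewrite /A /distz; lia.
have Aw l : A l -> weight l <= 1 by rewrite /A => Al; apply: w1; lia.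
have Bw l : B l -> weight l <= 1 by rewrite /B => Bl; apply: w1; lia.
(* 2 h_l is x_l, or x_l +- 1 when x_l is odd, with the sign making h_l even. So h_l is odd exactly
   on [B], where a later +-e_l restores parity. *)
pose h l := if B l then (x l %/ 2)%Z else 2 * c l.
pose a l := 2 * (h l - x l) - -1 * x l.
have a_abs l : absz (a l) = A l.
  rewrite /a /h /B; have := c_abs l; rewrite dist1 /A /B.
  by case: ifP; lia.
have xA l : A l -> x l != 0 by rewrite /A; lia.
have xB l : B l -> x l != 0 by rewrite /B; lia.
have h_half l (s : int) : s = 1 \/ s = -1 -> B l ->
    2 * ((h l + s) %/ 2)%Z = h l + s.
  by rewrite /h => s1 Bl; rewrite Bl; move: Bl; rewrite /B; lia.
have A_i : A i = false by rewrite /A; lia.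
have B_i : B i = false by rewrite /B; lia.
have ci0 : c i != 0 by apply: contraNneq xi => ci0; rewrite -ci ci0 mulr0.
pose RA : R := \sum_(l < 6) (A l)%:R; pose RB : R := \sum_(l < 6) (B l)%:R.
have bound1 := @distz_bound 4 1 i xi x4 isT.
have bound2 := @distz_bound 4 2 i xi x4 isT.
have AwE (l : nat) : (A l)%:R * weight l <= (A l)%:R.
  by case Al: (A l); rewrite ?mul1r ?mul0r // Aw.
have BwE (l : nat) : (B l)%:R * weight l <= (B l)%:R.
  by case Bl: (B l); rewrite ?mul1r ?mul0r // Bw.
have {}bound1 : 8 <= 1 + (RA + 2 * RB).
  apply: le_trans bound1 _; rewrite lerD2l mulr_sumr -big_split /=.
  apply: ler_sum => l _; rewrite mul1r dist1 natrD natrM.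
  by have := AwE l; have := BwE l; lra.
have {}bound2 : 8 <= 2 + 2 * RA.
  apply: le_trans bound2 _; rewrite lerD2l mulr_sumr.
  apply: ler_sum => l _; rewrite dist2 natrM.
  by have := AwE l; lra.
have ABle5 : RA + RB <= 5.
  rewrite -big_split /=.
  apply: (@sum6_le5 (fun l => (A l)%:R + (B l)%:R) i) => // [|l].
    by rewrite A_i B_i addr0.
  by rewrite -natrD lern1 /A /B; lia.
(* From 7 <= RA + 2 RB, 3 <= RA and RA + RB <= 5. *)
have RA3 : RA = 3 by lra.
have RB2 : RB <= 2 by lra.
have h_le : sqn (ivec h) <= mu.
  (* With d = 2, b = -1 and three odd coordinates the factor 1 + 3 - 4 on the right vanishes. *)
  have := @watson_ivec 2 (-1) a (fun l => h l - x l) x (fun=> erefl).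
  rewrite x_sqn; set T := \sum_(l < 6) _ * _; set S := \sum_(l < 6) _.
  have -> : S = RA by apply: eq_bigr => l _; rewrite -abszE a_abs.
  rewrite RA3 normrN1 sgrN1 mul1r.
  have -> : ivec (fun k => h k - x k - -1 * x k) = ivec h.
    by apply: eq_bigr => l _; congr (_%:~R *: _); ring.
  have T0 : 0 <= T.
    apply: sumr_ge0 => l _; rewrite -abszE a_abs.
    case Al: (A l); last by rewrite mul0r.
    rewrite mul1r subr_ge0 -weightK; last exact: xA.
    apply: le_trans (_ : mu <= _); first by rewrite ler_piMl ?(ltW mu_gt0) ?Aw.
    apply: (@min_le (fun k => h k - x k - Num.sg (a l) * (k == l)%:Z) i) => //.
    have /negPf-> : i != l by apply: contraTneq Al => <-; rewrite A_i.
    rewrite mulr0 subr0 /h B_i -ci.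
    by move: ci0; clear; lia.
  move=> E; suff: sqn (ivec h) - mu + T = 0 by lra.
  by rewrite E; ring.
pose f l := if B l then e l else 0.
have [s [s1 s_le]] := exists_signs 6 (ivec h) f.
pose c' l : int := if B l then ((h l + s l) %/ 2)%Z else c l.
have cE : 2%:R *: ivec c' = ivec h + \sum_(l < 6) (s l)%:~R *: f l.
  rewrite scaler_sumr -big_split; apply: eq_bigr => l _.
  rewrite scalerA -[2%:R]/(2%:~R) -intrM /f /c' /=.
  case Bl: (B l); last by rewrite /h Bl scaler0 addr0.
  by rewrite -scalerDl -intrD h_half.
have f_le : \sum_(l < 6) sqn (f l) <= 2 * mu.
  apply: le_trans (ler_wpM2r (ltW mu_gt0) RB2); rewrite mulr_suml.
  apply: ler_sum => l _; rewrite /f; case Bl: (B l); last by rewrite /sqn dot0r mul0r.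
  rewrite mul1r -weightK; first by rewrite ler_piMl ?(ltW mu_gt0) ?Bw.
  exact: xB.
have c'_ge : mu <= sqn (ivec c').
  by apply: (min_le i_n); rewrite /c' B_i.
(* So 4 q(c') <= q(h) + 2 mu <= 3 mu, against q(c') >= mu. *)
move: s_le; rewrite -cE sqnZ => s_le.
by have := mu_gt0; lra.
Qed.

End MinimalVector.

(** * Sums of distances, and integers without certain small divisors *)

(** Induction with step two: from p to p + 2 the sum grows by p + 1 and the square by 4 (p + 1). *)
Lemma sum_minn_le p : (4 * \sum_(t < p) minn t (p - t) <= p ^ 2)%N.
Proof.
suff: (4 * \sum_(t < p) minn t (p - t) <= p ^ 2)%N
   /\ (4 * \sum_(t < p.+1) minn t (p.+1 - t) <= p.+1 ^ 2)%N by case.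
elim: p => [|p [IH1 IH2]]; first by rewrite !big_ord_recl !big_ord0.
split=> //; rewrite big_ord_recl big_ord_recr /= min0n add0n.
under eq_bigr => t _ do rewrite /bump /=.
have E : (\sum_(t < p) minn (1 + t) (p.+2 - (1 + t))
          = \sum_(t < p) minn t (p - t) + p)%N.
  rewrite -[X in (_ + X)%N]card_ord -sum1_card -big_split.
  by apply: eq_bigr => t _ /=; have := ltn_ord t; lia.
rewrite E /bump; lia.
Qed.

(** Multiplication by y permutes the residues modulo p. *)
Lemma sum_distz_prime (p : nat) (y : int) : prime p -> ~~ (p %| y)%Z ->
  (\sum_(t < p) distz p (t%:Z * y) = \sum_(t < p) minn t (p - t))%N.
Proof.
move=> pp py; have p0 := prime_gt0 pp.
have p_neq0 : p%:Z != 0 by lia.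
have lt_p (t : nat) : (`|((t%:Z * y) %% p)%Z| < p)%N.
  by have := modz_ge0 (t%:Z * y) p_neq0; have := ltz_pmod (t%:Z * y) (_ : 0 < p%:Z); lia.
pose f (t : 'I_p) := Ordinal (lt_p t).
have f_inj : injective f.
  move=> s t /(congr1 val) /= E; apply: val_inj => /=.
  have /eqP : (s%:Z * y = t%:Z * y %[mod p])%Z.
    by rewrite -[LHS]gez0_abs ?modz_ge0 // E gez0_abs ?modz_ge0.
  rewrite eqz_mod_dvd -mulrBl; rewrite dvdzE abszM Euclid_dvdM // => /orP[|yp].
    case: (posnP (absz (s%:Z - t%:Z)%R)) => [|pos /(dvdn_leq pos)].
      by lia.
    by have := ltn_ord s; have := ltn_ord t; lia.
  by case/negP: py.
rewrite [RHS](reindex f) /=; first by [].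
exact: onW_bij (injF_bij f_inj).
Qed.

(** A larger |y| has a prime factor at least 5, or two prime factors in {2, 3}, counted with
    multiplicity, whose product is 4, 6 or 9. *)
Lemma abs_le3 (y : int) :
  ~~ (4 %| y)%Z -> ~~ (6 %| y)%Z -> ~~ (9 %| y)%Z ->
  (forall p, prime p -> (5 <= p)%N -> ~~ (p %| y)%Z) -> (`|y| <= 3)%N.
Proof.
rewrite !dvdzE /= => y4 y6 y9 y5; rewrite leqNgt; apply/negP => y3.
have small q : prime q -> (q %| `|y|)%N -> q = 2%N \/ q = 3%N.
  move=> qp qy; have := y5 q qp; rewrite dvdzE /= qy; have := prime_gt1 qp.
  by case: q qp {qy} => [|[|[|[|[|q]]]]] //; auto; move=> _ _ /(_ isT).
have p_pr : prime (pdiv `|y|) by rewrite pdiv_prime //; lia.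
have [z yz] := dvdnP (pdiv_dvd `|y|).
have z1 : (1 < z)%N by case: (small _ p_pr (pdiv_dvd _)) yz => ->; lia.
have q_pr := pdiv_prime z1; have [z' zz] := dvdnP (pdiv_dvd z).
have qy : (pdiv z %| `|y|)%N by rewrite yz dvdn_mulr // pdiv_dvd.
by case: (small _ p_pr (pdiv_dvd _)) yz => ->; case: (small _ q_pr qy) zz => ->; lia.
Qed.

Lemma abs_eq2 (y : int) : y != 0 -> (2 %| y)%Z -> (`|y| <= 3)%N -> `|y|%N = 2%N.
Proof. lia. Qed.

(** * Divisors of the coordinates *)

Section WeightedIndices.
Variables (R : realFieldType) (x : nat -> int) (w : nat -> R).

Definition tail_gcd j : nat := \big[gcdn/0%N]_(l < 6 | (j <= l)%N) `|x l|%N.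

(** The 1 accounts for m: averaging treats m as one more vector, with coordinate 1 and normalised
    square 1. *)
Definition weight_mod (d : nat) : R := 1 + \sum_(l < 6 | ~~ (d %| x l)%Z) w l.

Lemma dvd_tail_gcd j d :
  reflect (forall l, (j <= l < 6)%N -> (d%:Z %| x l)%Z) (d %| tail_gcd j)%N.
Proof.
apply: (iffP (dvdn_biggcdP _ _ _)) => dx => [l /andP[jl l6]|l jl].
  exact: (dx (Ordinal l6)).
by apply: (dx l); rewrite jl ltn_ord.
Qed.

Lemma tail_gcd5 : tail_gcd 5 = `|x 5%N|%N.
Proof.
by rewrite /tail_gcd big_mkcond !big_ord_recr big_ord0 /= !gcdn0 gcd0n.
Qed.

Hypotheses (w_ge0 : forall l, 0 <= w l)
  (distz_le_weights : forall (d t i : nat), (i < 6)%N ->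
     x i != 0 -> (d %| x i)%Z -> ~~ (d %| t)%N ->
     (2 * d)%:R <= (distz d t)%:R + \sum_(l < 6) (distz d (t%:Z * x l))%:R * w l)
  (w_coprime : forall j, (j < 6)%N -> tail_gcd j = 1%N -> w j <= 1)
  (w_gcd2 : forall j, (j < 6)%N -> tail_gcd j = 2%N ->
     4 * w j <= 1 + \sum_(l < 6 | ~~ (2 %| x l)%Z) w l)
  (w_gcd3 : forall j, (j < 6)%N -> tail_gcd j = 3%N ->
     5 * w j <= \sum_(l < 6) (distz 3 (x l))%:R * w l)
  (w_index4 : forall i, (i < 6)%N -> x i != 0 -> (4 %| x i)%Z ->
     ~ (forall l, (l < 6)%N -> ~~ (4 %| x l)%Z -> w l <= 1))
  (w_zero : forall l, x l = 0 -> w l = 0)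
  (w_first : w 0%N <= 1).

(* Sum the distance bound over the multipliers t in [s], repetitions allowed. *)
Lemma weight_mod_ge (d i : nat) (s : seq nat) (K : nat) : (i < 6)%N ->
  x i != 0 -> (d %| x i)%Z -> all (fun t => ~~ (d %| t)%N) s -> (1 < d)%N ->
  (forall y : int, ~~ (d %| y)%Z -> (\sum_(t <- s) distz d (t%:Z * y) <= K)%N) ->
  (size s * (2 * d))%:R <= K%:R * weight_mod d.
Proof.
move=> i6 xi dxi /allP s_d d1 sK.
have -> : (size s * (2 * d))%:R = \sum_(t <- s) (2 * d)%:R :> R.
  by rewrite big_const_seq count_predT iter_addr_0 mulnC natrM mulr_natr.
apply: le_trans (_ : \sum_(t <- s) ((distz d (t%:Z * 1))%:R +
   \sum_(l < 6) (distz d (t%:Z * x l))%:R * w l) <= _).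
  rewrite big_seq [X in _ <= X]big_seq; apply: ler_sum => t /s_d dt.
  by rewrite mulr1; exact: distz_le_weights i6 xi dxi dt.
rewrite big_split exchange_big mulrDr mulr1 /=; apply: lerD.
  by rewrite -natr_sum ler_nat sK // dvdzE /= dvdn1; lia.
rewrite mulr_sumr [X in _ <= X]big_mkcond; apply: ler_sum => l _.
rewrite -mulr_suml -natr_sum; case: ifPn => [dl|/negbNE dl].
  by rewrite ler_wpM2r // ler_nat sK.
by rewrite big1 ?mul0r // => t _; rewrite distz_dvd ?dvdz_mull.
Qed.

(** Distances depend only on residues, so the condition becomes a finite check on 0, ..., d - 1,
    stated with [foldr] so that it evaluates. *)
Lemma weight_mod_ge_check (d i : nat) (s : seq nat) (K N : nat) : (i < 6)%N ->
  x i != 0 -> (d %| x i)%Z ->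
  [&& N == (size s * (2 * d))%N, (1 < d)%N, all (fun t => ~~ (d %| t)%N) s &
    all (fun r => foldr addn 0 [seq distz d (t%:Z * r%:Z) | t <- s] <= K)%N
        (iota 0 d)] ->
  N%:R <= K%:R * weight_mod d.
Proof.
move=> i6 xi dxi /and4P[/eqP-> d1 s_d /allP check].
apply: (weight_mod_ge i6 xi dxi s_d d1) => y _.
have y0 : 0 <= (y %% d)%Z by rewrite modz_ge0 // -lt0n ltnW.
have yd : (y %% d)%Z < d by rewrite ltz_pmod // ltz_nat ltnW.
have /check : absz (y %% d)%Z \in iota 0 d.
  by move: y0 yd; case: (y %% d)%Z => // r _ rd; rewrite mem_iota.
rewrite foldrE big_map gez0_abs //.
by under eq_bigr do rewrite distz_modM.
Qed.

(** * Lower bounds on [weight_mod] from divisibility *)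

Lemma weight_mod2 i : (i < 6)%N -> x i != 0 -> (2 %| x i)%Z -> 4 <= weight_mod 2.
Proof. by move=> i6 xi xd; have := @weight_mod_ge_check 2 i [:: 1%N] 1 4 i6 xi xd isT; lra. Qed.

Lemma weight_mod3 i : (i < 6)%N -> x i != 0 -> (3 %| x i)%Z -> 6 <= weight_mod 3.
Proof. by move=> i6 xi xd; have := @weight_mod_ge_check 3 i [:: 1%N] 1 6 i6 xi xd isT; lra. Qed.

Lemma weight_mod6 i : (i < 6)%N -> x i != 0 -> (6 %| x i)%Z -> 7 <= weight_mod 6.
Proof.
move=> i6 xi xd.
(* With multiplicities 3, 3, 1 of the multipliers 1, 2, 3 the summed distance to 6Z is 12 for every
   nonzero residue; 84 / 12 = 7. *)
by have := @weight_mod_ge_check 6 i [:: 1; 1; 1; 2; 2; 2; 3]%N 12 84 i6 xi xd isT; lra.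
Qed.

Lemma weight_mod9 i : (i < 6)%N -> x i != 0 -> (9 %| x i)%Z -> 7 <= weight_mod 9.
Proof.
move=> i6 xi xd.
(* The summed distance to 9Z is 27 for every nonzero residue; 198 / 27 > 7. *)
have := @weight_mod_ge_check 9 i [:: 1; 1; 1; 2; 2; 2; 4; 4; 4; 3; 3]%N 27 198 i6 xi xd isT.
by rewrite /=; lra.
Qed.

(** All nonzero multipliers, with distance sum at most p^2 / 4, give 8 (p - 1) / p >= 20 / 3 once p
    >= 6; for p = 5 the multipliers 1 and 2 give 20 / 3. The threshold 13 / 2 is the upper bound in
    [weight_mod_le_at]. *)
Lemma weight_mod_prime i (p : nat) : (i < 6)%N -> x i != 0 -> (p %| x i)%Z -> prime p ->
  (5 <= p)%N -> 13 / 2 < weight_mod p.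
Proof.
move=> i6 xi xd pp; rewrite leq_eqVlt => /predU1P[p5|p5].
  rewrite -p5 in xd *.
  by have := @weight_mod_ge_check 5 i [:: 1; 2]%N 3 20 i6 xi xd isT; lra.
pose K := (\sum_(t < p) minn t (p - t))%N.
have K_le : (4 * K <= p ^ 2)%N := sum_minn_le p.
have := @weight_mod_ge p i (index_iota 1 p) K i6 xi xd; rewrite size_iota.
rewrite prime_gt1 // => /(_ _ isT) bound; have {bound} : ((p - 1) * (2 * p))%:R <= K%:R * weight_mod p.
  apply: bound => [|y py].
    apply/allP => t; rewrite mem_index_iota => /andP[t0 tp].
    by apply/negP => /(dvdn_leq t0); rewrite leqNgt tp.
  rewrite /K -(sum_distz_prime pp py) -(big_mkord xpredT (fun t => distz p (t%:Z * y))).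
  by rewrite [X in (_ <= X)%N]big_ltn ?prime_gt0 // leq_addl.
have W0 : 0 <= weight_mod p by rewrite addr_ge0 // sumr_ge0.
rewrite natrM natrM natrB ?prime_gt0 // => bound.
have {}K_le : 4 * K%:R <= p%:R ^+ 2 :> R by rewrite -natrX -natrM ler_nat.
have p6 : 6 <= p%:R :> R by rewrite ler_nat.
have : 8 * (p%:R - 1) * p%:R <= (p%:R * weight_mod p) * p%:R.
  by have := ler_wpM2r W0 K_le; move: bound; lra.
rewrite ler_pM2r; last by lra.
nra.
Qed.

Lemma weight_mod_le (d : nat) (b : nat -> R) :
  (forall l, (l < 6)%N -> ~~ (d %| x l)%Z -> w l <= b l) -> (forall l, 0 <= b l) ->
  weight_mod d <= 1 + (b 0%N + b 1%N + b 2%N + b 3%N + b 4%N + b 5%N).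
Proof.
move=> wb b0; rewrite lerD2l.
have -> : b 0%N + b 1%N + b 2%N + b 3%N + b 4%N + b 5%N = \sum_(l < 6) b l.
  by rewrite !big_ord_recr big_ord0 /= add0r.
rewrite [X in _ <= X](bigID (fun l : 'I_6 => ~~ (d %| x l)%Z)) /=.
apply: le_trans (_ : _ <= \sum_(l < 6 | ~~ (d %| x l)%Z) b l) _.
  by apply: ler_sum => l dl; apply: wb.
by rewrite lerDl sumr_ge0.
Qed.

(** If d divides the tail gcd, only indices l < j have d not dividing x_l, so [weight_mod d] <= 1 +
    j <= 6. With [w_index4] this leaves a nonzero gcd at most 3; the value 3 requires j = 5, and
    then [w_gcd3] gives 5 w_5 <= 5. *)
Lemma weight_step j : (j < 6)%N -> (forall l, (l < j)%N -> w l <= 1) ->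
  w j <= 1 \/
  tail_gcd j = 2%N /\ 4 * w j <= 1 + \sum_(l < 6 | (l < j)%N && ~~ (2 %| x l)%Z) 1.
Proof.
move=> j6 w1; set D := tail_gcd j.
have xD l : (j <= l < 6)%N -> (D %| x l)%Z by apply/dvd_tail_gcd.
have D_le (d : nat) : (d %| D)%N -> forall l, (l < 6)%N -> ~~ (d %| x l)%Z -> (l < j)%N.
  move=> dD l l6; apply: contraNT; rewrite -leqNgt => jl.
  by apply: dvdn_trans dD (xD l _); rewrite jl.
have [D0|D_neq0] := eqVneq D 0%N.
  left; rewrite w_zero //; have := xD j; rewrite D0 leqnn j6 => /(_ isT).
  by rewrite dvd0z => /eqP.
have [i /andP[ji i6] xi] : exists2 i, (j <= i < 6)%N & x i != 0.
  have [/existsP[i /andP[ji xi]]|] := boolP [exists i : 'I_6, (j <= i)%N && (x i != 0)].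
    by exists i; rewrite ?ji ?ltn_ord.
  move/existsPn => x0; case/negP: D_neq0; rewrite -dvd0n; apply/dvd_tail_gcd.
  move=> l /andP[jl l6]; have := x0 (Ordinal l6).
  by rewrite /= jl /= negbK => /eqP->.
have xdi (d : nat) : (d %| D)%N -> (d %| x i)%Z.
  by move=> dD; apply: dvdn_trans dD (xD i _); rewrite ji.
have W_le (d : nat) : (d %| D)%N -> weight_mod d <= 1 + j%:R.
  move=> dD; apply: le_trans (weight_mod_le (b := fun l => (l < j)%N%:R) _ _) _ => //.
    by move=> l l6 /(D_le _ dD _ l6) lj; rewrite lj w1.
  by rewrite lerD2l -!natrD ler_nat; move: (j) j6 => [|[|[|[|[|[|?]]]]]].
have j5 : j%:R <= 5 :> R by rewrite ler_nat.
have D3 : (D <= 3)%N.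
  apply: (@abs_le3 D).
  - apply/negP => dD; case: (w_index4 i6 xi (xdi _ dD)) => l l6.
    by move/(D_le _ dD _ l6); apply: w1.
  - by apply/negP => dD; have := weight_mod6 i6 xi (xdi _ dD); have := W_le _ dD; lra.
  - by apply/negP => dD; have := weight_mod9 i6 xi (xdi _ dD); have := W_le _ dD; lra.
  move=> p pp p5; apply/negP => dD.
  by have := weight_mod_prime i6 xi (xdi _ dD) pp p5; have := W_le _ dD; lra.
have [D1|[D2|D3']] : D = 1%N \/ D = 2%N \/ D = 3%N by lia.
- by left; apply: w_coprime.
- right; split=> //; apply: le_trans (w_gcd2 j6 D2) _; rewrite lerD2l.
  rewrite big_mkcond [X in _ <= X]big_mkcond; apply: ler_sum => l _ /=.
  case: ifPn => xl; last by rewrite andbF.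
  have lj : (l < j)%N by apply: (@D_le 2) xl; rewrite // D2.
  by rewrite lj w1.
(* Here 6 <= [weight_mod 3] <= 1 + j. *)
left; have j_eq5 : j = 5%N.
  have := weight_mod3 i6 xi (xdi 3%N _); have := W_le 3%N; rewrite D3' dvdnn.
  move=> /(_ isT) W6 /(_ isT) W5; have : 5 <= j%:R :> R by lra.
  by rewrite ler_nat; lia.
rewrite -(ler_pM2l (_ : 0 < 5)) // mulr1; apply: le_trans (w_gcd3 j6 D3') _.
apply: le_trans (_ : \sum_(l < 6) (l < 5)%N%:R <= 5); last first.
  by rewrite !big_ord_recr big_ord0 /=; lra.
apply: ler_sum => l _; have [lj|jl] := ltnP l j.
  have -> : (l < 5)%N by lia.
  apply: le_trans (_ : 1 * w l <= _).
    by rewrite ler_wpM2r // lern1; have := distz_le 3 (x l); lia.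
  by rewrite mul1r w1.
have /distz_dvd-> : (3 %| x l)%Z.
  by have := xD l; rewrite D3' jl ltn_ord => /(_ isT).
by rewrite mul0r ler0n.
Qed.

(** * Case analysis on the lengths of the basis vectors *)

Definition oddx l := ~~ (2 %| x l)%Z.

Lemma weight_step_count j : (j < 6)%N -> (forall l, (l < j)%N -> w l <= 1) ->
  w j <= 1 \/
  tail_gcd j = 2%N /\ 4 * w j <= 1 + ((0 < j) && oddx 0 + ((1 < j) && oddx 1)
    + ((2 < j) && oddx 2) + ((3 < j) && oddx 3) + ((4 < j) && oddx 4))%N%:R.
Proof.
move=> j6 w1; case: (weight_step j6 w1) => [|[D2 wj]]; [by left | right].
split=> //; apply: le_trans wj _; rewrite lerD2l.
rewrite (_ : \sum_(l < 6 | _) 1 = (\sum_(l < 6) ((l < j)%N && oddx l : nat))%N%:R).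
  rewrite !big_ord_recr big_ord0 /= ler_nat.
  by have -> : (5 < j)%N = false by [lia]; rewrite addn0 add0n.
by rewrite natr_sum big_mkcond; apply: eq_bigr => l _; case: ifP.
Qed.

(** Otherwise the distance bound with d = 4 and t = 1 would make the sum in the last hypothesis at
    least 8; index i has distance 0 to 4Z. *)
Lemma not_dvd4 i (b : nat -> R) (c : nat -> nat) : (i < 6)%N -> x i != 0 ->
  (forall l, (l < 6)%N -> l != i -> w l <= b l) ->
  (forall l, (l < 6)%N -> l != i -> (distz 4 (x l) <= c l)%N) ->
  (forall l, 0 <= b l) ->
  1 + ((c 0%N)%:R * b 0%N + (c 1%N)%:R * b 1%N + (c 2%N)%:R * b 2%N
    + (c 3%N)%:R * b 3%N + (c 4%N)%:R * b 4%N + (c 5%N)%:R * b 5%N) < 8 ->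
  ~~ (4 %| x i)%Z.
Proof.
move=> i6 xi wb dc b0; apply: contraTN => x4; rewrite -leNgt.
apply: le_trans (@distz_le_weights 4 1 i i6 xi x4 isT) _; rewrite lerD2l.
apply: (@le_trans _ _ (\sum_(l < 6) (c l)%:R * b l)); last first.
  by rewrite !big_ord_recr big_ord0 /= add0r.
apply: ler_sum => l _; rewrite mul1r.
have [->|li] := eqVneq (l : nat) i; first by rewrite distz_dvd ?mul0r ?mulr_ge0.
apply: (le_trans (ler_wpM2l (ler0n _ _) (wb l (ltn_ord l) li))).
by rewrite ler_wpM2r // ler_nat dc.
Qed.

Lemma distz4_odd l : oddx l -> (distz 4 (x l) <= 1)%N.
Proof. by rewrite /oddx /distz; clear; lia. Qed.

Lemma abs_le3_of_weight_mod i : (i < 6)%N -> x i != 0 ->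
  (forall d : nat, (d %| x i)%Z -> weight_mod d <= 13 / 2) ->
  ~~ (4 %| x i)%Z -> (`|x i| <= 3)%N.
Proof.
move=> i6 xi W_le x4; apply: abs_le3 => //.
- by apply/negP => d6; have := weight_mod6 i6 xi d6; have := W_le 6%N d6; lra.
- by apply/negP => d9; have := weight_mod9 i6 xi d9; have := W_le 9%N d9; lra.
move=> p pp p5; apply/negP => dp.
by have := weight_mod_prime i6 xi dp pp p5; have := W_le p dp; lra.
Qed.

(** For j <= 3 even the weaker alternative 4 w_j <= 1 + j gives w_j <= 1. If w_4 > 1, then x_0, ...,
    x_3 must be odd and x_4, x_5 even; if only w_5 > 1, the tail gcd 2 is |x_5|. *)
Lemma weight_cases :
  (forall l, (l < 4)%N -> w l <= 1) /\
  [\/ w 4%N <= 1 /\ w 5%N <= 1,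
      [/\ (forall l, (l < 4)%N -> oddx l), ~~ oddx 4, ~~ oddx 5,
          w 4%N <= 5 / 4 & w 5%N <= 5 / 4]
    | [/\ w 4%N <= 1, `|x 5%N|%N = 2%N, 1 < w 5%N &
          4 * w 5%N <= 1 + (oddx 0 + oddx 1 + oddx 2 + oddx 3 + oddx 4)%N%:R]].
Proof.
have le_nat (k m : nat) : (k <= m)%N -> k%:R <= m%:R :> R by rewrite ler_nat.
have w1 : w 1%N <= 1.
  case: (@weight_step_count 1) => [//|l|//|[_ /=]]; first by case: l.
  by rewrite !addn0; have := @le_nat (oddx 0) 1%N (leq_b1 _); lra.
have w2 : w 2%N <= 1.
  case: (@weight_step_count 2) => [//|l|//|[_ /=]]; first by case: l => [|[|]].
  by rewrite !addn0; have := @le_nat (oddx 0 + oddx 1)%N 2%N ltac:(lia); lra.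
have w3 : w 3%N <= 1.
  case: (@weight_step_count 3) => [//|l|//|[_ /=]]; first by case: l => [|[|[|]]].
  by rewrite !addn0; have := @le_nat (oddx 0 + oddx 1 + oddx 2)%N 3%N ltac:(lia); lra.
have w_lt4 l : (l < 4)%N -> w l <= 1 by case: l => [|[|[|[|]]]].
split=> //; have [w4|w4] := leP (w 4%N) 1.
  have w_lt5 l : (l < 5)%N -> w l <= 1.
    by rewrite ltnS leq_eqVlt => /predU1P[->|/w_lt4].
  have [w5|w5] := leP (w 5%N) 1; first by constructor 1.
  case: (weight_step_count _ w_lt5) => [//||[D2 w5']]; first by rewrite leNgt w5.
  constructor 3; split=> //.
  by rewrite -tail_gcd5.
case: (weight_step_count _ w_lt4) => [//||[D2 w4']]; first by rewrite leNgt w4.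
have tail_even l : (4 <= l < 6)%N -> ~~ oddx l.
  by move=> l46; rewrite negbK; apply: (dvd_tail_gcd 4 2 _) l46; rewrite D2.
have odd4 : (4 <= oddx 0 + oddx 1 + oddx 2 + oddx 3)%N.
  rewrite ltnNge; apply/negP => /le_nat c3.
  by move: w4'; rewrite /= addn0; lra.
have odd_lt4 l : (l < 4)%N -> oddx l.
  move: odd4; case: l => [|[|[|[|]]]] // + _;
    by case: (oddx 0); case: (oddx 1); case: (oddx 2); case: (oddx 3).
have w4_le : w 4%N <= 5 / 4.
  by move: w4'; rewrite /= !odd_lt4 //=; lra.
constructor 2; split=> //; try exact: tail_even.
have [x5|x5] := eqVneq (x 5%N) 0; first by rewrite w_zero //; lra.
have lt56 : (5 < 6)%N by [].
have o5 := tail_even 5%N isT.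
have x5_le3 : (`|x 5%N| <= 3)%N.
  (* 1 + 4 + 5/4 <= 13/2 bounds [weight_mod], and 1 + 4 + 2 * 5/4 < 8 excludes the divisor 4. *)
  apply: abs_le3_of_weight_mod => // [d d5|].
    apply: (@le_trans _ _ (1 + (1 + 1 + 1 + 1 + 5 / 4 + 0))); last by lra.
    apply: (weight_mod_le
      (b := fun l => if (l < 4)%N then 1 else if l == 4%N then 5 / 4 else 0)).
    - by move=> [|[|[|[|[|[|l]]]]]] // _; rewrite ?d5 ?w_lt4.
    - by move=> l; case: ifP => // _; case: ifP => // _; lra.
  apply: (@not_dvd4 5 (fun l => if (l < 4)%N then 1 else 5 / 4)
    (fun l => if (l < 4)%N then 1 else if l == 4%N then 2 else 0)%N) => //.
  - by move=> [|[|[|[|[|[|l]]]]]] // _ _; rewrite w_lt4.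
  - move=> [|[|[|[|[|[|l]]]]]] // _ _; try exact/distz4_odd/odd_lt4.
    by rewrite -(leq_pmul2l (isT : 0 < 2)%N) distz_le.
  - by move=> l; case: ifP => // _; lra.
  by rewrite /=; lra.
have x5_2 : `|x 5%N|%N = 2%N by apply: abs_eq2 (negbNE o5) x5_le3.
have D5 : tail_gcd 5 = 2%N by rewrite tail_gcd5.
(* As x_4 and x_5 are even, 4 w_5 <= 1 + w_0 + w_1 + w_2 + w_3 <= 5. *)
have := w_gcd2 lt56 D5; rewrite big_mkcond !big_ord_recr big_ord0 /=.
rewrite -/(oddx 0) -/(oddx 1) -/(oddx 2) -/(oddx 3) -/(oddx 4) -/(oddx 5).
rewrite (odd_lt4 0%N) // (odd_lt4 1%N) // (odd_lt4 2%N) // (odd_lt4 3%N) //.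
rewrite (negPf (tail_even 4%N isT)) (negPf o5).
by move: (w_lt4 0%N isT) (w_lt4 1%N isT) (w_lt4 2%N isT) w3; lra.
Qed.


(** In the three cases (b_4, b_5) is (1, 1), (5/4, 5/4) or (1, 3/2), the last because at most five
    odd coordinates give 4 w_5 <= 6. *)
Lemma weight_bound : exists b : nat -> R,
  [/\ (forall l, 0 <= b l), (forall l, (l < 6)%N -> w l <= b l),
      b 0%N = 1 /\ b 1%N = 1 /\ b 2%N = 1 /\ b 3%N = 1,
      1 <= b 4%N <= 5 / 4 & 1 <= b 5%N <= 5 / 2 - b 4%N].
Proof.
have [w1 cases] := weight_cases.
pose b (b4 b5 : R) l := if (l < 4)%N then 1 else if l == 4%N then b4 else b5.
have bE b4 b5 : 1 <= b4 <= 5 / 4 -> 1 <= b5 <= 5 / 2 - b4 ->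
    w 4%N <= b4 -> w 5%N <= b5 -> [/\ (forall l, 0 <= b b4 b5 l),
      (forall l, (l < 6)%N -> w l <= b b4 b5 l),
      b b4 b5 0%N = 1 /\ b b4 b5 1%N = 1 /\ b b4 b5 2%N = 1 /\ b b4 b5 3%N = 1,
      1 <= b4 <= 5 / 4 & 1 <= b5 <= 5 / 2 - b4].
  move=> h4 h5 w4 w5; split=> //; last by move=> [|[|[|[|[|[|l]]]]]] // _; rewrite w1.
  by move=> l; rewrite /b; case: ifP => // _; case: ifP; lra.
case: cases => [[w4 w5]|[_ _ _ w4 w5]|[w4 _ _ w5]].
- by exists (b 1 1); apply: bE => //; lra.
- by exists (b (5 / 4) (5 / 4)); apply: bE => //; lra.
exists (b 1 (3 / 2)); apply: bE => //; try lra.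
suff : (oddx 0 + oddx 1 + oddx 2 + oddx 3 + oddx 4)%N%:R <= 5 :> R by lra.
rewrite ler_nat.
by case: (oddx 0); case: (oddx 1); case: (oddx 2); case: (oddx 3); case: (oddx 4).
Qed.

(** * Bounds on the coordinates *)

(** Index i drops out of the sum and b_i >= 1, which leaves 1 + 4 + 5/2 - 1, 1 + 4 + 5/4 - 1 and 1 +
    3 - 1. *)
Lemma weight_mod_le_at i (d : nat) : (i < 6)%N -> x i != 0 -> (d %| x i)%Z ->
  weight_mod d <= 13 / 2 /\ (x 5%N = 0 -> weight_mod d <= 21 / 4) /\
  (x 3%N = 0 -> x 4%N = 0 -> x 5%N = 0 -> weight_mod d <= 3).
Proof.
have [b [b0 wb [b0E [b1E [b2E b3E]]] b4 b5]] := weight_bound.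
move=> i6 xi di.
have le (P : pred nat) : (forall l, P l -> (d %| x l)%Z) ->
    let b' l := if P l || (l == i) then 0 else b l in
    weight_mod d <= 1 + (b' 0%N + b' 1%N + b' 2%N + b' 3%N + b' 4%N + b' 5%N).
  move=> Pd; apply: weight_mod_le => [l l6 dl|l]; last by case: ifP.
  case: ifPn => [/orP[/Pd dl'|/eqP li]|_]; last exact: wb.
    by rewrite dl' in dl.
  by rewrite li di in dl.
split; [|split].
- clear xi; have none l : xpred0 l -> (d %| x l)%Z by [].
  have := le xpred0 none; rewrite /= b0E b1E b2E b3E.
  by case: i {di le} i6 => [|[|[|[|[|[|i]]]]]] //= _; lra.
- move=> x5; have := le (pred1 5%N); rewrite /= b0E b1E b2E b3E.
  have x5d l : l == 5%N -> (d %| x l)%Z by move/eqP->; rewrite x5 dvdz0.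
  by move=> /(_ x5d); case: i {di le} i6 xi => [|[|[|[|[|[|i]]]]]] //= _; rewrite ?x5 ?eqxx // => _; lra.
move=> x3 x4 x5; have := le (fun l => [|| l == 3, l == 4 | l == 5]%N).
have x345 l : [|| l == 3, l == 4 | l == 5]%N -> (d %| x l)%Z.
  by move=> /or3P[] /eqP->; rewrite ?x3 ?x4 ?x5 dvdz0.
rewrite /= b0E b1E b2E => /(_ x345).
by case: i {di le} i6 xi => [|[|[|[|[|[|i]]]]]] //= _; rewrite ?x3 ?x4 ?x5 ?eqxx // => _; lra.
Qed.

(** With all weights at most 1 this is [w_index4]. In the other cases four coordinates besides x_i
    are odd with weight at most 1 and the remaining one has weight at most 5/4, so 4 | x_i would
    give 8 <= 1 + 4 + 2 * 5/4. *)
Lemma not_dvd4_x i : (i < 6)%N -> x i != 0 -> ~~ (4 %| x i)%Z.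
Proof.
move=> i6 xi; have even_i : (4 %| x i)%Z -> ~~ oddx i.
  by rewrite negbK; apply: dvdn_trans.
have [w1 cases] := weight_cases; apply/negP => x4; have {}even_i := even_i x4.
case: cases => [[w4 w5]|[odd_lt4 o4 o5 w4 w5]|[w4 x5 w5 w5']].
- apply: (w_index4 i6 xi x4) => l l6 _.
  by case: l l6 => [|[|[|[|[|[|l]]]]]] // _; apply: w1.
- have i4 : (4 <= i)%N by rewrite leqNgt; apply: contra even_i => /odd_lt4.
  suff: ~~ (4 %| x i)%Z by rewrite x4.
  apply: (@not_dvd4 i (fun l => if (l < 4)%N then 1 else 5 / 4)
    (fun l => if (l < 4)%N then 1 else if l == i then 0 else 2)%N) => //.
  + by move=> [|[|[|[|[|[|l]]]]]] // _ _; rewrite w1.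
  + move=> [|[|[|[|[|[|l]]]]]] // _ li; try exact/distz4_odd/odd_lt4.
      by rewrite (negPf li) -(leq_pmul2l (isT : 0 < 2)%N) distz_le.
    by rewrite (negPf li) -(leq_pmul2l (isT : 0 < 2)%N) distz_le.
  + by move=> l; case: ifP => // _; lra.
  by case: i i6 i4 {xi x4 even_i} => [|[|[|[|[|[|l]]]]]] //= _ _; lra.
have i5 : (i < 5)%N.
  rewrite ltn_neqAle -ltnS i6 andbT; apply/eqP => i5.
  by move: x4; rewrite i5 dvdzE x5.
(* 1 < w_5 needs four odd coordinates among x_0, ..., x_4; as x_i is even, these are exactly the
   others, and 4 w_5 <= 5. *)
have odd_sum : (4 <= oddx 0 + oddx 1 + oddx 2 + oddx 3 + oddx 4)%N.
  rewrite ltnNge; apply/negP; rewrite -(ler_nat R) => c3.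
  by move: w5'; lra.
have odd_ne l : (l < 5)%N -> l != i -> oddx l.
  move: odd_sum even_i; case: i i5 {i6 xi x4} => [|[|[|[|[|i]]]]] // _;
  case: l => [|[|[|[|[|l]]]]] // + + _;
  by case: (oddx 0); case: (oddx 1); case: (oddx 2); case: (oddx 3); case: (oddx 4).
have {}w5 : w 5%N <= 5 / 4.
  suff : (oddx 0 + oddx 1 + oddx 2 + oddx 3 + oddx 4)%N%:R <= 4 :> R by lra.
  rewrite ler_nat; case: i i5 even_i {i6 xi x4 odd_ne} => [|[|[|[|[|i]]]]] // _ /negPf->;
  by case: (oddx 0); case: (oddx 1); case: (oddx 2); case: (oddx 3); case: (oddx 4).
suff: ~~ (4 %| x i)%Z by rewrite x4.
apply: (@not_dvd4 i (fun l => if (l < 5)%N then 1 else 5 / 4)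
  (fun l => if (l < 5)%N then (l != i : nat) else 2)%N) => //.
- by move=> [|[|[|[|[|[|l]]]]]] // _ _; rewrite ?w1.
- move=> l l6 li; case: ifP => [l5|_].
    by rewrite li; apply/distz4_odd/odd_ne.
  by rewrite -(leq_pmul2l (isT : 0 < 2)%N) distz_le.
- by move=> l; case: ifP => // _; lra.
by case: i i5 {i6 xi x4 odd_ne even_i} => [|[|[|[|[|l]]]]] //= _; lra.
Qed.

Lemma abs_x_le3 i : (i < 6)%N -> (`|x i| <= 3)%N.
Proof.
move=> i6; have [->//|xi] := eqVneq (x i) 0.
apply: abs_le3_of_weight_mod => // [d di|]; last exact: not_dvd4_x.
by have [] := weight_mod_le_at i6 xi di.
Qed.

(** A coordinate +-3 would give [weight_mod 3] >= 6 > 21/4. *)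
Lemma abs_x_le2 i : (i < 6)%N -> x 5%N = 0 -> (`|x i| <= 2)%N.
Proof.
move=> i6 x5; have [->//|xi] := eqVneq (x i) 0.
rewrite -ltnS ltn_neqAle abs_x_le3 // andbT; apply/eqP => x3.
have d3 : (3 %| x i)%Z by rewrite dvdzE x3.
have [_ [W_le _]] := weight_mod_le_at i6 xi d3.
by have := weight_mod3 i6 xi d3; have := W_le x5; lra.
Qed.

(** A coordinate +-2 would give [weight_mod 2] >= 4 > 3. *)
Lemma abs_x_le1 i : (i < 6)%N -> x 3%N = 0 -> x 4%N = 0 -> x 5%N = 0 ->
  (`|x i| <= 1)%N.
Proof.
move=> i6 x3 x4 x5; have [->//|xi] := eqVneq (x i) 0.
rewrite -ltnS ltn_neqAle abs_x_le2 // andbT; apply/eqP => x2.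
have d2 : (2 %| x i)%Z by rewrite dvdzE x2.
have [_ [_ W_le]] := weight_mod_le_at i6 xi d2.
by have := weight_mod2 i6 xi d2; have := W_le x3 x4 x5; lra.
Qed.

End WeightedIndices.

(** * Minkowski-reduced bases *)

Lemma sqn_gt0 (R : realType) (n : nat) (v : 'rV[R]_n) : v != 0 -> 0 < sqn v.
Proof.
move=> v0; rewrite lt_def sqn_ge0 andbT; apply: contra v0 => /eqP sv.
apply/eqP/rowP => j; rewrite mxE; apply/eqP; rewrite -sqrf_eq0.
have := psumr_eq0P (fun i _ => sqr_ge0 (v 0 i)) _ (isT : xpredT j) => -> //.
Qed.

Lemma ivec_nth (R : realType) (n : nat) (e : n.-tuple 'rV[R]_n) (u : nat -> int) :
  (n <= 6)%N -> ivec (nth 0 e) u = \sum_(l < n) e`_l *~ u l.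
Proof.
move=> n6; rewrite (big_ord_widen _ (fun l => e`_l *~ u l) n6) big_mkcond.
apply: eq_bigr => l _; rewrite scaler_int; case: ifP => // /negbT.
by rewrite -leqNgt => nl; rewrite nth_default ?size_tuple // mul0rz.
Qed.

Section MinkowskiReduced.
Variables (R : realType) (n : nat) (L : set 'rV[R]_n) (e : n.-tuple 'rV[R]_n).
Hypotheses (n6 : (n <= 6)%N) (he : minkowski_reduced L e).

Let basis : lattice_basis L e. Proof. by case: he. Qed.

Lemma ivec_lattice u : L (ivec (nth 0 e) u).
Proof.
case: basis => _ ->; rewrite ivec_nth //; apply: int_span_sum => l _.
by apply/int_spanMz/int_span_mem; rewrite mem_nth ?size_tuple.
Qed.

Lemma ivec_neq0 (u : nat -> int) l : (l < n)%N -> u l != 0 -> ivec (nth 0 e) u != 0.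
Proof.
move=> ln; apply: contraNneq; rewrite ivec_nth // => /(congr1 (coord e (Ordinal ln))).
case: basis => fe _; rewrite (coord_int (fun i => u i)) // linear0 => /eqP.
by rewrite intr_eq0.
Qed.

Lemma minkowski_reduced_le j (u : nat -> int) : (j < n)%N ->
  (forall d : nat, (forall l, (j <= l < n)%N -> (d%:Z %| u l)%Z) -> d = 1%N) ->
  sqn (nth 0 e j) <= sqn (ivec (nth 0 e) u).
Proof.
move=> jn gu; have [_ [_ _ e0_min] e_red] := he; rewrite -enorm_le.
(* At index 0 the definition asks for a minimal vector of L, and coprimality makes u nonzero. *)
case: j jn gu => [|j] jn gu.
  have [/existsP[l ul]|] := boolP [exists l : 'I_n, u l != 0].
    by apply: e0_min; [exact: ivec_lattice | exact: ivec_neq0 ul].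
  move/existsPn => u0; suff: 2%N = 1%N by [].
  by apply: gu => l ln; have := u0 (Ordinal ln); rewrite negbK => /eqP->.
have [_] := e_red j.+1 jn; apply; rewrite ivec_nth //.
apply: (@primitive_extension_coprime _ _ _ _ _ (fun l => u l)) => // d du.
by apply: gu => l /andP[jl ln]; apply: (du (Ordinal ln)).
Qed.

Variables (m : 'rV[R]_n) (x : nat -> int).
Hypotheses (hm : minimal_vector L m) (mE : m = ivec (nth 0 e) x)
  (x_out : forall l, (n <= l)%N -> x l = 0).

Let mu := sqn m.

Lemma mu_gt0 : 0 < mu.
Proof. by case: hm => _ m0 _; apply: sqn_gt0. Qed.

Lemma mu_le (u : nat -> int) l : (l < n)%N -> u l != 0 -> mu <= sqn (ivec (nth 0 e) u).
Proof.
move=> ln ul; case: hm => _ _ m_min; rewrite -enorm_le.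
by apply: m_min; [exact: ivec_lattice | exact: ivec_neq0 ul].
Qed.

Lemma tail_gcd_lt j : tail_gcd x j != 0%N -> (j < n)%N.
Proof.
apply: contraR; rewrite -leqNgt -dvd0n => nj; apply/dvd_tail_gcd => l /andP[jl _].
by rewrite x_out // (leq_trans nj).
Qed.

Lemma dvd_tail_gcd_n j (d : nat) :
  (forall l, (j <= l < n)%N -> (d%:Z %| x l)%Z) -> (d %| tail_gcd x j)%N.
Proof.
move=> dx; apply/dvd_tail_gcd => l /andP[jl _].
by have [ln|nl] := ltnP l n; [rewrite dx ?jl | rewrite x_out ?dvdz0].
Qed.

Lemma tail_gcd_dvd j l : (j <= l < n)%N -> ((tail_gcd x j)%:Z %| x l)%Z.
Proof.
move=> /andP[jl ln]; have /dvd_tail_gcd := dvdnn (tail_gcd x j); apply.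
by rewrite jl (leq_trans ln).
Qed.

(** The inequalities for minimal vectors become the hypotheses on weights, always over six indices;
    the vanishing conditions cover n <= 5 and n <= 3. *)
Lemma minimal_coordinates i : (i < 6)%N ->
  [/\ (`|x i| <= 3)%N, (x 5%N = 0 -> `|x i| <= 2)%N
    & (x 3%N = 0 -> x 4%N = 0 -> x 5%N = 0 -> `|x i| <= 1)%N].
Proof.
move=> i6; pose w := weight (nth 0 e) mu x.
have x_sqn : sqn (ivec (nth 0 e) x) = mu by rewrite /mu mE.
have w0 l : 0 <= w l by apply: weight_ge0 mu_gt0 l.
have w_dist (d t k : nat) : (k < 6)%N -> x k != 0 -> (d %| x k)%Z -> ~~ (d %| t)%N ->
    (2 * d)%:R <= (distz d t)%:R + \sum_(l < 6) (distz d (t%:Z * x l))%:R * w l.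
  move=> _; exact: (distz_bound n6 mu_gt0 mu_le x_out x_sqn).
have n_of j (k : nat) : tail_gcd x j = k.+1 -> (j < n)%N.
  by move=> D; apply: tail_gcd_lt; rewrite D.
have dvd_half j (k : nat) : tail_gcd x j = k.+1 -> forall d : nat,
    (forall l, (j <= l < n)%N -> ((k.+1 * d)%N%:Z %| x l)%Z) -> d = 1%N.
  move=> D d /dvd_tail_gcd_n; rewrite D -[X in (_ %| X)%N]muln1 dvdn_pmul2l //.
  by rewrite dvdn1 => /eqP.
have w_coprime j : (j < 6)%N -> tail_gcd x j = 1%N -> w j <= 1.
  move=> _ D; apply: (weight_le1_of_coprime mu_gt0 minkowski_reduced_le x_sqn).
    exact: n_of D.
  by move=> d /dvd_tail_gcd_n; rewrite D dvdn1 => /eqP.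
have w_gcd2 j : (j < 6)%N -> tail_gcd x j = 2%N ->
    4 * w j <= 1 + \sum_(l < 6 | ~~ (2 %| x l)%Z) w l.
  move=> _ D; apply: (weight_le_of_gcd2 n6 mu_gt0 minkowski_reduced_le x_sqn).
  - exact: n_of D.
  - by move=> l /tail_gcd_dvd; rewrite D.
  exact: dvd_half D.
have w_gcd3 j : (j < 6)%N -> tail_gcd x j = 3%N ->
    5 * w j <= \sum_(l < 6) (distz 3 (x l))%:R * w l.
  move=> _ D; apply: (weight_le_of_gcd3 n6 mu_gt0 mu_le minkowski_reduced_le x_out x_sqn).
  - exact: n_of D.
  - by move=> l /tail_gcd_dvd; rewrite D.
  exact: dvd_half D.
have w_index4 k : (k < 6)%N -> x k != 0 -> (4 %| x k)%Z ->
    ~ (forall l, (l < 6)%N -> ~~ (4 %| x l)%Z -> w l <= 1).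
  move=> _ xk x4 w1; apply: (index4_has_heavy n6 mu_gt0 mu_le x_out x_sqn xk x4).
  move=> l xl; apply: w1 => //; rewrite ltnNge; apply: contra xl => l6.
  by rewrite x_out ?dvdz0 // (leq_trans n6).
have w_zero l : x l = 0 -> w l = 0 by rewrite /w /weight => ->; rewrite eqxx.
have w_first : w 0%N <= 1.
  rewrite /w /weight; case: eqP => // _; rewrite ler_pdivrMr ?mu_gt0 // mul1r.
  by case: he => _ [_ _ e0_min] _; case: hm => Lm m0 _; rewrite -enorm_le e0_min.
split; first exact: (abs_x_le3 w0 w_dist w_coprime w_gcd2 w_gcd3 w_index4 w_zero w_first).
  exact: (abs_x_le2 w0 w_dist w_coprime w_gcd2 w_gcd3 w_index4 w_zero w_first).
exact: (abs_x_le1 w0 w_dist w_coprime w_gcd2 w_gcd3 w_index4 w_zero w_first).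
Qed.

End MinkowskiReduced.

Theorem theorem1 (R : realType) (n : nat) (hn : (2 <= n <= 6)%N)
    (L : set 'rV[R]_n) (hL : is_lattice L)
    (e : n.-tuple 'rV[R]_n) (he : minkowski_reduced L e)
    (m : 'rV[R]_n) (hm : minimal_vector L m)
    (x : 'I_n -> int) (hx : m = \sum_(i < n) e`_i *~ x i) :
  forall i : 'I_n,
    `|x i| <= (if (n <= 3)%N then 1 else if (n <= 5)%N then 2 else 3 : int).
Proof.
move=> i; have /andP[_ n6] := hn.
(* Extension of x by 0; its vanishing from n on selects the bound for n <= 3 or n <= 5. *)
pose y (l : nat) : int := oapp x 0 (insub l).
have yE (l : 'I_n) : y l = x l by rewrite /y valK.
have y_out l : (n <= l)%N -> y l = 0 by move=> nl; rewrite /y insubN // -leqNgt.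
have mE : m = ivec (nth 0 e) y.
  by rewrite ivec_nth // hx; apply: eq_bigr => l _; rewrite yE.
have [b3 b2 b1] := minimal_coordinates n6 he hm mE y_out (leq_trans (ltn_ord i) n6).
rewrite -yE; case: ifP => [n3|_].
  have := b1 (y_out 3%N n3) (y_out 4%N (leqW n3)) (y_out 5%N (leqW (leqW n3))).
  by clear; lia.
case: ifP => [n5|_]; first by have := b2 (y_out 5%N n5); clear; lia.
by move: b3; clear; lia.
Qed.
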